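(* Let $M<N$ and $1\le k\le N$ be positive integers. For each pair partition $\mathfrak{m}\in\mathcal{P}_k$, \begin{align*} \mathrm{Wg}^{\mathbf{A}}(\mathfrak{m})={}&-\frac1N\sum_{i=1}^{2k-2}\mathrm{Wg}^{\mathbf{A}}((i~2k-1)\cdot\mathfrak{m})+\frac MN\,\delta_{\{2k-1,2k\}\in\mathfrak{m}}\,\mathrm{Wg}^{\mathbf{A}}(\mathfrak{m}^\downarrow)\\ &+\frac1N\sum_{i=1}^{2k-2}\delta_{\{i,2k\}\in\mathfrak{m}}\,\mathrm{Wg}^{\mathbf{A}}([(i~2k-1)\cdot\mathfrak{m}]^\downarrow), \end{align*} where $\delta_{\{i,j\}\in\mathfrak{m}}$ is $1$ if $\{i,j\}\in\mathfrak{m}$ and $0$ otherwise.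
   Context: $\mathbf{A}(M,N)$ is the space of $N\times N$ real symmetric idempotent matrices of rank $M$, i.e. $\{OI_{M,N}O^T:O\in\mathrm{O}(N)\}$ with $I_{M,N}=\mathrm{diag}(1,\ldots,1,0,\ldots,0)$ ($M$ ones), with the Haar probability measure $\mathrm{d}\mu$ induced from $\mathrm{O}(N)$; $A_{ij}$ is the $(i,j)$ entry. $\mathcal{P}_k$ is the set of pair partitions of $\{1,\ldots,2k\}$ (partitions into two-element blocks), $\mathcal{P}_0=\{(~)\}$ the empty pair partition. The symmetric group $S_{2k}$ acts on $\mathcal{P}_k$ by $\{a,b\}\in\mathfrak{m}\iff\{\sigma(a),\sigma(b)\}\in\sigma\cdot\mathfrak{m}$. If $\{2k-1,2k\}\in\mathfrak{m}$, $\mathfrak{m}^\downarrow\in\mathcal{P}_{k-1}$ is obtained by deleting this block. A function $i:\{1,\ldots,2k\}\to\{1,\ldots,N\}$ is strongly admissible for $\mathfrak{m}$ if for all $a\neq b$, $\{a,b\}\in\mathfrak{m}\iff i(a)=i(b)$. The Weingarten function is $\mathrm{Wg}^{\mathbf{A}}(\mathfrak{m})=\int_{\mathbf{A}(M,N)}A_{i(1)i(2)}\cdots A_{i(2k-1)i(2k)}\,\mathrm{d}\mu$ for any strongly admissible $i$ (independent of the choice), and $\mathrm{Wg}^{\mathbf{A}}((~))=1$. *)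

(* Defs.v *)
From HB Require Import structures.
From mathcomp Require Import all_boot all_order all_algebra.
From mathcomp Require Import all_classical all_reals all_analysis.
Set Implicit Arguments. Unset Strict Implicit. Unset Printing Implicit Defensive.
Import Order.TTheory GRing.Theory Num.Theory.
Local Open Scope classical_set_scope.
Local Open Scope ring_scope.

(** Pair partitions of {0,...,2k-1} (0-indexed version of {1,...,2k}),
    represented as fixed-point-free involutions m : nat -> nat of [0,2k):
    {a,b} is a block iff m a = b.  Values outside [0,2k) are irrelevant. *)
Definition is_pairing (k : nat) (m : nat -> nat) : Prop :=
  forall a, (a < k.*2)%N -> [/\ (m a < k.*2)%N, m a != a & m (m a) = a].

Definition transp (a b : nat) (x : nat) : nat :=
  if x == a then b else if x == b then a else x.

(** action sigma . m = sigma o m o sigma^-1 ; for a transposition sigma^-1 = sigma *)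
Definition act_transp (a b : nat) (m : nat -> nat) : nat -> nat :=
  transp a b \o m \o transp a b.

(** Canonical strongly admissible index function for a pairing m of [0,2k):
    a |-> number of blocks whose minimum is smaller than the minimum of the
    block of a.  (Values are < k.) *)
Definition canon_idx (k : nat) (m : nat -> nat) (a : nat) : nat :=
  count (fun b => (b < m b) && (b < minn a (m a)))%N (iota 0 k.*2).

Definition orthogonal_mx (R : realType) (N : nat) (U : 'M[R]_N) : Prop :=
  U *m U^T = 1%:M.

Section Haar.
Context (R : realType) (d : measure_display) (T : measurableType d)
        (P : probability T R) (N : nat) (O : 'I_N -> 'I_N -> T -> R).

Definition Omat (t : T) : 'M[R]_N := \matrix_(i, j) O i j t.

(** O is a Haar-distributed random orthogonal matrix: entries are random
    variables, O(t) is orthogonal, and the joint law of the entries is invariant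
    under left multiplication by any fixed orthogonal matrix (checked on
    measurable rectangles, which generate the product sigma-algebra). *)
Definition haar_orthogonal : Prop :=
  [/\ (forall i j, measurable_fun setT (O i j)),
      (forall t, orthogonal_mx (Omat t)) &
      (forall U : 'M[R]_N, orthogonal_mx U ->
        forall B : 'I_N -> 'I_N -> set R, (forall i j, measurable (B i j)) ->
          P [set t | forall i j, B i j (O i j t)] =
          P [set t | forall i j, B i j ((U *m Omat t) i j)])].

(** A = O I_{M,N} O^T, Haar-distributed on A(M,N) *)
Definition Amat (M : nat) (t : T) : 'M[R]_N :=
  Omat t *m pid_mx M *m (Omat t)^T.

Definition Aent (M : nat) (t : T) (a b : nat) : R :=
  match insub a, insub b with
  | Some i, Some j => Amat M t i j
  | _, _ => 0
  end.

(** Weingarten function Wg^A(m) = int A_{i(1)i(2)} ... A_{i(2k-1)i(2k)} dmu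
    with i the canonical strongly admissible function; Wg^A(()) = 1. *)
Definition WgA (M k : nat) (m : nat -> nat) : R :=
  Rintegral P setT (fun t => \prod_(j < k)
     Aent M t (canon_idx k m j.*2) (canon_idx k m j.*2.+1)).

End Haar.

(* Main.v *)
Require Import Defs.
From HB Require Import structures.
From mathcomp Require Import all_boot all_order all_algebra.
From mathcomp Require Import fingroup perm.
From mathcomp Require Import all_classical all_reals all_analysis.
From mathcomp Require Import measurable_realfun.
From mathcomp Require Import zify ring lra.
Import Order.TTheory GRing.Theory Num.Theory.
Import numFieldNormedType.Exports.
Set Implicit Arguments.
Unset Strict Implicit.
Unset Printing Implicit Defensive.
Local Open Scope classical_set_scope.
Local Open Scope ring_scope.

(* Write z = 2k-2, y = 2k-1 for the last two (0-indexed) positions, and let f be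
   strongly admissible for m. Put an index l on the block {z, m z} of f and sum
   the resulting moment over l in two ways.
   Contracting the summed index gives tr A = M when m z = y, and A^2 = A
   otherwise: this is the right-hand side in level k-1.
   On the other hand, if l is not used on another block the moment is Wg(m),
   while if l = f(a) = f(m a) the index l occurs four times, and isotropy of the
   law of A splits the moment into the three pairings of {a, m a, z, m z}, i.e.
   Wg(m) + Wg((a z).m) + Wg((m a z).m). The total is N Wg(m) + sum_a Wg((a z).m)
   over a outside {z, m z}; when m z <> y, the term a = y equals Wg(m) because A
   is symmetric, and stands for the missing a = m z.
   Invariance of the law is only given on rectangles of entries; these form a
   pi-system, so it extends to polynomial moments. *)

(** * Boundedness and measurability of polynomials in matrix entries *)

Section BoundedOn.
Context {R : realType} {T : Type} (S : set T).

(** The bound is asked on [S] only: polynomials in the entries are bounded on the orthogonal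
    matrices but not on all matrices. *)
Definition bounded_on (f : T -> R) := exists C, forall x, S x -> `|f x| <= C.

Lemma bounded_on_cst c : bounded_on (fun=> c).
Proof. by exists `|c|. Qed.

Lemma bounded_onD f g :
  bounded_on f -> bounded_on g -> bounded_on (fun x => f x + g x).
Proof.
move=> [C fC] [D gD]; exists (C + D) => x Sx.
by rewrite (le_trans (ler_normD _ _))// lerD ?fC ?gD.
Qed.

Lemma bounded_onM f g :
  bounded_on f -> bounded_on g -> bounded_on (fun x => f x * g x).
Proof.
move=> [C fC] [D gD]; exists (C * D) => x Sx.
by rewrite normrM ler_pM ?fC ?gD.
Qed.

Lemma bounded_on_sum I (s : seq I) (f : I -> T -> R) :
  (forall i, bounded_on (f i)) -> bounded_on (fun x => \sum_(i <- s) f i x).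
Proof.
move=> bf; elim: s => [|i s IH].
  by under eq_fun do rewrite big_nil; exact: bounded_on_cst.
by under eq_fun do rewrite big_cons; exact: bounded_onD.
Qed.

Lemma bounded_on_prod I (s : seq I) (f : I -> T -> R) :
  (forall i, bounded_on (f i)) -> bounded_on (fun x => \prod_(i <- s) f i x).
Proof.
move=> bf; elim: s => [|i s IH].
  by under eq_fun do rewrite big_nil; exact: bounded_on_cst.
by under eq_fun do rewrite big_cons; exact: bounded_onM.
Qed.

Lemma bounded_on_mulmx m n p (A : T -> 'M[R]_(m, n)) (B : T -> 'M[R]_(n, p)) :
  (forall i j, bounded_on (fun x => A x i j)) ->
  (forall i j, bounded_on (fun x => B x i j)) ->
  forall i j, bounded_on (fun x => (A x *m B x) i j).
Proof.
move=> bA bB i j; under eq_fun do rewrite mxE.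
by apply: bounded_on_sum => l; exact: bounded_onM.
Qed.

End BoundedOn.

Lemma measurable_mulmx (R : realType) d (T : measurableType d) m n p
    (A : T -> 'M[R]_(m, n)) (B : T -> 'M[R]_(n, p)) :
  (forall i j, measurable_fun setT (fun x => A x i j)) ->
  (forall i j, measurable_fun setT (fun x => B x i j)) ->
  forall i j, measurable_fun setT (fun x => (A x *m B x) i j).
Proof.
move=> bA bB i j; under eq_fun do rewrite mxE.
by apply: measurable_sum => l; exact: measurable_funM.
Qed.

(** * The sigma-algebra on matrices generated by rectangles of entries *)

Section Rectangles.
Context (R : realType) (N : nat).

(** These are the events on which [haar_orthogonal] states invariance. *)
Definition mx_rectangle : set (set 'M[R]_N) :=
  [set A | exists2 B : 'I_N -> 'I_N -> set R, (forall i j, measurable (B i j)) &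
     A = [set X : 'M[R]_N | forall i j, B i j (X i j)]].

Definition mxBorel := g_sigma_algebraType mx_rectangle.
HB.instance Definition _ := Measurable.on mxBorel.

Lemma measurable_mx_entry i j :
  measurable_fun setT (fun X : mxBorel => (X : 'M[R]_N) i j).
Proof.
move=> _ B mB; rewrite setTI; apply: sub_sigma_algebra.
exists (fun i' j' => if (i' == i) && (j' == j) then B else setT).
  by move=> i' j'; case: ifP.
apply/seteqP; split=> [X /= BX i' j'|X /(_ i j)]; last by rewrite !eqxx.
by case: ifP => // /andP[/eqP-> /eqP->].
Qed.

Lemma measurable_mxP d (T : measurableType d) (f : T -> mxBorel) :
  (forall i j, measurable_fun setT (fun t => (f t : 'M[R]_N) i j)) ->
  measurable_fun setT f.
Proof.
move=> mf; apply: (@measurability _ _ _ mxBorel _ _ mx_rectangle) => //.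
move=> _ [_ [B mB ->] <-]; rewrite setTI.
rewrite (_ : _ @^-1` _ = \bigcap_(ij : 'I_N * 'I_N)
    ((fun t => (f t : 'M[R]_N) ij.1 ij.2) @^-1` B ij.1 ij.2)).
  apply: fin_bigcap_measurable => // -[i j] _.
  by rewrite -[_ @^-1` _]setTI; exact: mf.
by apply/seteqP; split=> [t /= + [i j] _|t /= + i j]; [exact|move/(_ (i, j)); exact].
Qed.

Lemma setI_closed_mx_rectangle : setI_closed mx_rectangle.
Proof.
move=> _ _ [B mB ->] [C mC ->].
exists (fun i j => B i j `&` C i j); first by move=> i j; exact: measurableI.
by apply/seteqP; split=> [X [BX CX] i j|X BC] //=; split=> i j; case: (BC i j).
Qed.

End Rectangles.

(** * Haar invariance and multilinear moments of A *)

Section Haar.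
Context (R : realType) (d : measure_display) (T : measurableType d)
        (P : probability T R) (N : nat) (O : 'I_N -> 'I_N -> T -> R).
Hypothesis haarO : haar_orthogonal P O.

Lemma Omat_orthogonal t : orthogonal_mx (Omat O t).
Proof. by have [_ + _] := haarO; exact. Qed.

(** Row [i] of [X] is a unit vector, so the square of one of its entries is at most 1. *)
Lemma orthogonal_mx_entry_le1 (X : 'M[R]_N) i j : orthogonal_mx X -> `|X i j| <= 1.
Proof.
move=> /(congr1 (fun Y : 'M[R]_N => Y i i)); rewrite !mxE eqxx => XX.
rewrite -ler_sqr ?nnegrE// expr1n real_normK ?num_real//.
rewrite -[leRHS]/(true%:R) -XX (bigD1 j)//= mxE -expr2 lerDl sumr_ge0// => l _.
by rewrite mxE -expr2 sqr_ge0.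
Qed.

Lemma measurable_Omat : measurable_fun setT (Omat O : T -> mxBorel R N).
Proof.
apply: measurable_mxP => i j; under eq_fun do rewrite mxE.
by case: haarO => + _ _; exact.
Qed.

Lemma measurable_mul_Omat (U : 'M[R]_N) :
  measurable_fun setT (fun t => U *m Omat O t : mxBorel R N).
Proof.
apply: measurable_mxP => i j; under eq_fun do rewrite mxE.
apply: measurable_sum => l; apply: measurable_funM => //.
by under eq_fun do rewrite mxE; case: haarO => + _ _; exact.
Qed.

Lemma orthogonal_mxM (U V : 'M[R]_N) :
  orthogonal_mx U -> orthogonal_mx V -> orthogonal_mx (U *m V).
Proof.
move=> UU VV; rewrite /orthogonal_mx trmx_mul mulmxA -(mulmxA U) VV.
by rewrite mulmx1.
Qed.

Lemma bounded_integrable (f : T -> R) : measurable_fun setT f ->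
  bounded_on setT f -> P.-integrable setT (EFin \o f).
Proof.
move=> mf [C fC]; apply: measurable_bounded_integrable => //.
  exact: (le_lt_trans (probability_le1 P measurableT) (ltry 1)).
exists C; split; first exact: num_real.
by move=> y Cy t _ /=; rewrite (le_trans (fC _ I))// ltW.
Qed.

Lemma integrable_Omat (F : 'M[R]_N -> R) :
  measurable_fun [set: mxBorel R N] F ->
  bounded_on (@orthogonal_mx R N) F ->
  P.-integrable setT (EFin \o (fun t => F (Omat O t))).
Proof.
move=> mF [C FC]; apply: bounded_integrable.
  exact: (measurableT_comp mF measurable_Omat).
by exists C => t _; exact/FC/Omat_orthogonal.
Qed.

(** Both sides integrate [F] against laws on matrices, those of [Omat O] and [U *m Omat O]. These
    are finite measures that agree on a generating pi-system, hence are equal; a bound on orthogonal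
    matrices suffices because both random matrices are orthogonal. *)
Lemma haar_invariance (U : 'M[R]_N) (F : 'M[R]_N -> R) : orthogonal_mx U ->
  measurable_fun [set: mxBorel R N] F ->
  bounded_on (@orthogonal_mx R N) F ->
  \int[P]_t F (Omat O t) = \int[P]_t F (U *m Omat O t).
Proof.
move=> oU mF bF; have [C FC] := bF.
have mO := measurable_Omat.
have mUO := measurable_mul_Omat U.
have mF' : measurable_fun [set: mxBorel R N] (EFin \o F) by exact/measurable_EFinP.
congr fine.
have iF : P.-integrable setT (EFin \o (fun t => F (Omat O t))).
  exact: integrable_Omat.
have iUF : P.-integrable setT (EFin \o (fun t => F (U *m Omat O t))).
  apply: bounded_integrable; first exact: (measurableT_comp mF mUO).
  by exists C => t _; apply: FC; exact/orthogonal_mxM/Omat_orthogonal.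
transitivity (\int[pushforward P (Omat O : T -> mxBorel R N)]_X (F X)%:E)%E.
  by rewrite (integral_pushforward mO mF')// preimage_setT.
transitivity (\int[pushforward P (fun t => U *m Omat O t : mxBorel R N)]_X
    (F X)%:E)%E; last by rewrite (integral_pushforward mUO mF')// preimage_setT.
apply: eq_measure_integral => A mA _.
apply: (measure_unique (T := mxBorel R N) (@mx_rectangle R N) (fun=> setT) erefl
  (@setI_closed_mx_rectangle R N)) => //.
- by move=> _; exists (fun _ _ => setT) => //; apply/seteqP; split.
- by rewrite bigcup_const.
- move=> _ [B mB ->]; rewrite /pushforward /preimage/=.
  have [_ _ /(_ _ oU _ mB) PB] := haarO; rewrite -[RHS]PB.
  by congr (P _); apply/seteqP; split=> t /= + i j => /(_ i j); rewrite mxE.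
- by move=> _; exact: (le_lt_trans (probability_le1 P measurableT) (ltry 1)).
Qed.

Context (M : nat).

Definition qform (X : 'M[R]_N) (u w : 'rV[R]_N) : R :=
  (u *m (X *m pid_mx M *m X^T) *m w^T) 0 0.

(** Vectors in place of indices make the moment linear in each position, so that its value in a
    rotated frame can be expanded. *)
Definition moment (k : nat) (v : nat -> 'rV[R]_N) : R :=
  \int[P]_t \prod_(j < k) qform (Omat O t) (v j.*2) (v j.*2.+1).

Lemma bounded_on_qform u w :
  bounded_on (@orthogonal_mx R N) (fun X => qform X u w).
Proof.
have bc m n (A : 'M[R]_(m, n)) i j :
    bounded_on (@orthogonal_mx R N) (fun=> A i j) by exact: bounded_on_cst.
have bX i j : bounded_on (@orthogonal_mx R N) (fun X => X i j).
  by exists 1 => X; exact: orthogonal_mx_entry_le1.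
do ![apply: bounded_on_mulmx => // ? ?].
by under eq_fun do rewrite mxE.
Qed.

Lemma measurable_qform u w :
  measurable_fun [set: mxBorel R N] (fun X => qform X u w).
Proof.
have mX := @measurable_mx_entry R N.
have mXT i j : measurable_fun setT (fun X : mxBorel R N => (X : 'M[R]_N)^T i j).
  rewrite (_ : (fun X : mxBorel R N => _) = fun X : mxBorel R N =>
    (X : 'M[R]_N) j i); first exact: mX.
  by apply/funext => X; rewrite mxE.
by do 4!apply: measurable_mulmx => //.
Qed.

Lemma measurable_moment k (v : nat -> 'rV[R]_N) :
  measurable_fun [set: mxBorel R N]
    (fun X => \prod_(j < k) qform X (v j.*2) (v j.*2.+1)).
Proof. by apply: measurable_prod => j _; exact: measurable_qform. Qed.

Lemma bounded_on_moment k (v : nat -> 'rV[R]_N) :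
  bounded_on (@orthogonal_mx R N)
    (fun X => \prod_(j < k) qform X (v j.*2) (v j.*2.+1)).
Proof. by apply: bounded_on_prod => j; exact: bounded_on_qform. Qed.

Lemma integrable_moment k (v : nat -> 'rV[R]_N) :
  P.-integrable setT
    (EFin \o (fun t => \prod_(j < k) qform (Omat O t) (v j.*2) (v j.*2.+1))).
Proof.
exact: (integrable_Omat (@measurable_moment k v) (@bounded_on_moment k v)).
Qed.

Lemma eq_moment k (v w : nat -> 'rV[R]_N) :
  (forall x, (x < k.*2)%N -> v x = w x) -> moment k v = moment k w.
Proof.
move=> vw; apply: eq_Rintegral => t _; apply: eq_bigr => j _.
by rewrite !vw //; have := ltn_ord j; lia.
Qed.

(** Multiplying all vectors by [U] amounts to replacing O by U O, which the invariance of the law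
    absorbs. *)
Lemma moment_mulmx k (v : nat -> 'rV[R]_N) (U : 'M[R]_N) :
  orthogonal_mx U -> moment k (fun x => v x *m U) = moment k v.
Proof.
move=> oU; rewrite [RHS](haar_invariance oU (@measurable_moment k v)
  (@bounded_on_moment k v)).
apply: eq_Rintegral => t _; apply: eq_bigr => j _; congr (_ _ 0 0).
by rewrite !trmx_mul !mulmxA.
Qed.

Definition upd {A : Type} (v : nat -> A) a x : nat -> A :=
  fun n => if n == a then x else v n.

Lemma qformDl X u u' w : qform X (u + u') w = qform X u w + qform X u' w.
Proof. by rewrite /qform !mulmxDl mxE. Qed.

Lemma qformDr X u w w' : qform X u (w + w') = qform X u w + qform X u w'.
Proof. by rewrite /qform linearD/= mulmxDr mxE. Qed.

Lemma qformZl X c u w : qform X (c *: u) w = c * qform X u w.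
Proof. by rewrite /qform -!scalemxAl mxE. Qed.

Lemma qformZr X c u w : qform X u (c *: w) = c * qform X u w.
Proof. by rewrite /qform linearZ/= -scalemxAr mxE. Qed.

(** Position [a] occurs only in factor [a./2], on the right or on the left according to its parity.
    Isolating that factor gives linearity in position [a] when [q] is [qform], and contraction of an
    index when [q] is an entry of A. *)
Lemma prod_upd (A : Type) (q : A -> A -> R) k v a x (ak : (a < k.*2)%N) :
  \prod_(j < k) q (upd v a x j.*2) (upd v a x j.*2.+1) =
  (if odd a then q (v a.-1) x else q x (v a.+1)) *
  \prod_(j < k | j != a./2 :> nat) q (v j.*2) (v j.*2.+1).
Proof.
have ak2 : (a./2 < k)%N by lia.
have aE := odd_double_half a.
rewrite (bigD1 (Ordinal ak2))//=; congr (_ * _).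
  rewrite /upd; case: (odd a) aE => aE.
    have -> : a./2.*2 = a.-1 by lia.
    by rewrite ifN ?ifT//; lia.
  have -> : a./2.*2 = a by lia.
  by rewrite ifT ?ifN//; lia.
apply: eq_big => [j|j ja]; first by [].
have {}ja : nat_of_ord j != a./2 by [].
by rewrite /upd !ifN//; lia.
Qed.

Lemma moment_updD k v a x y : (a < k.*2)%N ->
  moment k (upd v a (x + y)) = moment k (upd v a x) + moment k (upd v a y).
Proof.
move=> ak; rewrite /moment -RintegralD//; last 2 first.
- exact: (integrable_moment k (upd v a x)).
- exact: (integrable_moment k (upd v a y)).
apply: eq_Rintegral => t _; rewrite !(prod_upd (qform (Omat O t)))//.
by rewrite -mulrDl; case: ifP => _; rewrite ?qformDl ?qformDr.
Qed.

Lemma moment_updZ k v a c x : (a < k.*2)%N ->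
  moment k (upd v a (c *: x)) = c * moment k (upd v a x).
Proof.
move=> ak; rewrite /moment -RintegralZl//; last first.
  exact: (integrable_moment k (upd v a x)).
apply: eq_Rintegral => t _; rewrite !(prod_upd (qform (Omat O t)))//.
by rewrite mulrA; case: ifP => _; rewrite ?qformZl ?qformZr.
Qed.

Definition unit_vec (i : 'I_N) : 'rV[R]_N := delta_mx 0 i.

Definition dot (u w : 'rV[R]_N) : R := (u *m w^T) 0 0.

Lemma dot_unit_vec i j : dot (unit_vec i) (unit_vec j) = (i == j)%:R.
Proof.
by rewrite /dot trmx_delta mul_delta_mx_cond; case: eqP; rewrite !mxE ?eqxx.
Qed.

Lemma dotC u w : dot u w = dot w u.
Proof. by rewrite /dot -[u in LHS]trmxK -trmx_mul mxE. Qed.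

Lemma dotDl u u' w : dot (u + u') w = dot u w + dot u' w.
Proof. by rewrite /dot mulmxDl mxE. Qed.

Lemma dotZl c u w : dot (c *: u) w = c * dot u w.
Proof. by rewrite /dot -scalemxAl mxE. Qed.

Lemma dotNl u w : dot (- u) w = - dot u w.
Proof. by rewrite -scaleN1r dotZl mulN1r. Qed.

(** The matrix with rows [r i] is orthogonal and sends [unit_vec i] to [r i]. *)
Lemma moment_frame k (f : nat -> 'I_N) (r : 'I_N -> 'rV[R]_N) :
  (forall i j, dot (r i) (r j) = (i == j)%:R) ->
  moment k (r \o f) = moment k (unit_vec \o f).
Proof.
move=> rr; pose U : 'M[R]_N := \matrix_i r i.
rewrite -(@moment_mulmx k (unit_vec \o f) U); last first.
  apply/matrixP => i j; rewrite !mxE -rr /dot !mxE.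
  by apply: eq_bigr => l _; rewrite !mxE.
by apply: eq_moment => x _ /=; rewrite /unit_vec -rowE rowK.
Qed.

End Haar.

(** * Isotropic four-linear forms on a plane *)

Section FourLinear.
Context (R : realType) (V : lmodType R) (K : V -> V -> V -> V -> R).
Hypotheses
  (K1D : forall x y b c e, K (x + y) b c e = K x b c e + K y b c e)
  (K2D : forall x y a c e, K a (x + y) c e = K a x c e + K a y c e)
  (K3D : forall x y a b e, K a b (x + y) e = K a b x e + K a b y e)
  (K4D : forall x y a b c, K a b c (x + y) = K a b c x + K a b c y)
  (K1Z : forall s x b c e, K (s *: x) b c e = s * K x b c e)
  (K2Z : forall s x a c e, K a (s *: x) c e = s * K a x c e)
  (K3Z : forall s x a b e, K a b (s *: x) e = s * K a b x e)
  (K4Z : forall s x a b c, K a b c (s *: x) = s * K a b c x).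

(* Averaging over the rotation by an angle pi/4 in the plane of [p] and [q]:
   the eight terms of odd degree in [q] cancel by the reflection [q |-> - q]. *)
Lemma isotropic_four_linear (p q : V) (s : R) : s ^+ 2 = 2^-1 ->
  let inv (p' q' : V) := forall b1 b2 b3 b4 : bool,
    K (if b1 then q' else p') (if b2 then q' else p')
      (if b3 then q' else p') (if b4 then q' else p') =
    K (if b1 then q else p) (if b2 then q else p)
      (if b3 then q else p) (if b4 then q else p) in
  inv p (- q) -> inv q p -> inv (s *: (p + q)) (s *: (p - q)) ->
  K p p p p = K p p q q + K p q p q + K p q q p.
Proof.
move=> s2 inv isign iswap irot.
have K1N x b c e : K (- x) b c e = - K x b c e by rewrite -scaleN1r K1Z mulN1r.
have K2N x b c e : K b (- x) c e = - K b x c e by rewrite -scaleN1r K2Z mulN1r.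
have K3N x b c e : K b c (- x) e = - K b c x e by rewrite -scaleN1r K3Z mulN1r.
have K4N x b c e : K b c e (- x) = - K b c e x by rewrite -scaleN1r K4Z mulN1r.
have := irot false false false false; rewrite /= K1Z K2Z K3Z K4Z.
rewrite !(K1D, K2D, K3D, K4D).
have := isign true false false false; have := isign false true false false.
have := isign false false true false; have := isign false false false true.
have := isign true true true false; have := isign true true false true.
have := isign true false true true; have := isign false true true true.
rewrite /= !(K1N, K2N, K3N, K4N).
have := iswap false false false false; have := iswap false false true true.
have := iswap false true false true; have := iswap false true true false.
rewrite /= => -> -> -> -> ? ? ? ? ? ? ? ?.
(* Let S be the sum of the three pairings. After the exchange of [p] and [q], the surviving terms
   read [K p p p p = s ^+ 4 * (2 * K p p p p + 2 * S)], and [s ^+ 4] is 1/4. *)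
rewrite !mulrA (_ : s * s * s * s = (s ^+ 2) ^+ 2); last by ring.
rewrite s2; lra.
Qed.

End FourLinear.

(** * Splitting a moment in which an index occurs four times *)

Section FourFold.
Context (R : realType) (d : measure_display) (T : measurableType d)
        (P : probability T R) (N : nat) (O : 'I_N -> 'I_N -> T -> R) (M : nat).
Hypothesis haarO : haar_orthogonal P O.

Lemma upd_comm (A : Type) (v : nat -> A) a b x y : a != b ->
  upd (upd v a x) b y = upd (upd v b y) a x.
Proof.
move=> ab; apply/funext => n; rewrite /upd.
by case: (eqVneq n b) ab => // ->; case: (eqVneq b a).
Qed.

Definition upd4 (A : Type) (v : nat -> A) a b c e x1 x2 x3 x4 :=
  upd (upd (upd (upd v e x4) c x3) b x2) a x1.

Lemma moment_four k (f : nat -> 'I_N) a b c e (p q : 'I_N) :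
  [&& a < k.*2, b < k.*2, c < k.*2 & e < k.*2]%N ->
  uniq [:: a; b; c; e] -> p != q ->
  (forall x, (x < k.*2)%N -> x \notin [:: a; b; c; e] ->
     (f x != p) && (f x != q)) ->
  let K i1 i2 i3 i4 :=
    moment P O M k (@unit_vec R N \o upd4 f a b c e i1 i2 i3 i4) in
  K p p p p = K p p q q + K p q p q + K p q q p.
Proof.
move=> /and4P[ak bk ck ek]; rewrite /= !inE => ab pq fpq /=.
pose ev := @unit_vec R N.
pose K x1 x2 x3 x4 := moment P O M k (upd4 (ev \o f) a b c e x1 x2 x3 x4).
have KE i1 i2 i3 i4 : moment P O M k (ev \o upd4 f a b c e i1 i2 i3 i4) =
    K (ev i1) (ev i2) (ev i3) (ev i4).
  apply: eq_moment => x _; rewrite /upd4 /upd /=.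
  by do 4!case: ifP => _ //.
have Kframe (r : 'I_N -> 'rV[R]_N) i1 i2 i3 i4 :
    (forall i j, dot (r i) (r j) = (i == j)%:R) ->
    (forall i, i != p -> i != q -> r i = ev i) ->
    K (r i1) (r i2) (r i3) (r i4) = K (ev i1) (ev i2) (ev i3) (ev i4).
  move=> rr rE; rewrite -KE.
  rewrite -(moment_frame haarO M k (upd4 f a b c e i1 i2 i3 i4) rr).
  apply: eq_moment => x xk; rewrite /upd4 /upd /=.
  case: (eqVneq x a) => // xa; case: (eqVneq x b) => // xb.
  case: (eqVneq x c) => // xc; case: (eqVneq x e) => // xe.
  have /andP[fp fq] : (f x != p) && (f x != q).
    by apply: fpq; rewrite // !inE (negPf xa) (negPf xb) (negPf xc).
  by rewrite rE.
have [ba ca ea] : [/\ b != a, c != a & e != a] by split; move: ab; lia.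
have [cb eb ec] : [/\ c != b, e != b & e != c] by split; move: ab; lia.
(* The positions are distinct, so any of the four updates can be brought outermost, where
   [moment_updD] and [moment_updZ] apply. *)
have K2E x1 x2 x3 x4 : K x1 x2 x3 x4 =
    moment P O M k (upd (upd (upd (upd (ev \o f) e x4) c x3) a x1) b x2).
  by rewrite /K /upd4 upd_comm.
have K3E x1 x2 x3 x4 : K x1 x2 x3 x4 =
    moment P O M k (upd (upd (upd (upd (ev \o f) e x4) b x2) a x1) c x3).
  by rewrite /K /upd4 (@upd_comm _ _ c b)// (@upd_comm _ _ c a).
have K4E x1 x2 x3 x4 : K x1 x2 x3 x4 =
    moment P O M k (upd (upd (upd (upd (ev \o f) c x3) b x2) a x1) e x4).
  rewrite /K /upd4 (@upd_comm _ _ e c)// (@upd_comm _ _ e b)//.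
  by rewrite (@upd_comm _ _ e a).
have qp : q != p by rewrite eq_sym.
rewrite !KE; pose s : R := Num.sqrt 2^-1.
have s2 : s ^+ 2 = 2^-1 by rewrite sqr_sqrtr// invr_ge0 ler0n.
apply: (isotropic_four_linear _ _ _ _ _ _ _ _ s2).
- by move=> *; rewrite /K /upd4 (moment_updD haarO).
- by move=> *; rewrite !K2E (moment_updD haarO).
- by move=> *; rewrite !K3E (moment_updD haarO).
- by move=> *; rewrite !K4E (moment_updD haarO).
- by move=> *; rewrite /K /upd4 (moment_updZ haarO).
- by move=> *; rewrite !K2E (moment_updZ haarO).
- by move=> *; rewrite !K3E (moment_updZ haarO).
- by move=> *; rewrite !K4E (moment_updZ haarO).
(* The three required symmetries are instances of [Kframe]: a sign change at [q], the exchange of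
   [p] and [q], and the normalized sum and difference of the two unit vectors. *)
- move=> b1 b2 b3 b4.
  pose r i := if i == q then - ev q else ev i.
  pose g (b : bool) := if b then q else p.
  have := @Kframe r (g b1) (g b2) (g b3) (g b4).
  have rg b0 : r (g b0) = if b0 then - ev q else ev p.
    by case: b0; rewrite /r /g ?eqxx// (negPf pq).
  have eg b0 : ev (g b0) = if b0 then ev q else ev p by case: b0.
  rewrite !rg !eg; apply; last by move=> i _ /negPf; rewrite /r => ->.
  move=> i j; rewrite /r; case: (eqVneq i q) => [->|iq].
    rewrite dotNl dotC; case: (eqVneq j q) => [_|jq].
      by rewrite dotNl dot_unit_vec eqxx opprK.
    by rewrite dot_unit_vec (negPf jq) oppr0.
  case: (eqVneq j q) => [->|jq]; last by rewrite dot_unit_vec.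
  by rewrite dotC dotNl dot_unit_vec (negPf iq) eq_sym (negPf iq) oppr0.
- move=> b1 b2 b3 b4.
  pose r i := ev (tperm p q i).
  pose g (b : bool) := if b then q else p.
  have := @Kframe r (g b1) (g b2) (g b3) (g b4).
  have rg b0 : r (g b0) = if b0 then ev p else ev q.
    by case: b0; rewrite /r /g ?tpermL ?tpermR.
  have eg b0 : ev (g b0) = if b0 then ev q else ev p by case: b0.
  rewrite !rg !eg; apply; last by move=> i ip iq; rewrite /r tpermD// eq_sym.
  by move=> i j; rewrite dot_unit_vec (inj_eq perm_inj).
- move=> b1 b2 b3 b4.
  pose r i := if i == p then s *: (ev p + ev q) else
    if i == q then s *: (ev p - ev q) else ev i.
  pose g (b : bool) := if b then q else p.
  have := @Kframe r (g b1) (g b2) (g b3) (g b4).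
  have rg b0 : r (g b0) = if b0 then s *: (ev p - ev q) else s *: (ev p + ev q).
    by case: b0; rewrite /r /g ?eqxx// (negPf qp).
  have eg b0 : ev (g b0) = if b0 then ev q else ev p by case: b0.
  rewrite !rg !eg; apply; last by move=> i /negPf ip /negPf iq; rewrite /r ip iq.
  have dpp : dot (ev p) (ev p) = 1 by rewrite dot_unit_vec eqxx.
  have dqq : dot (ev q) (ev q) = 1 by rewrite dot_unit_vec eqxx.
  have dpq : dot (ev p) (ev q) = 0 by rewrite dot_unit_vec (negPf pq).
  have dqp : dot (ev q) (ev p) = 0 by rewrite dotC.
  have dpo i : i != p -> dot (ev i) (ev p) = 0.
    by move=> ip; rewrite dot_unit_vec (negPf ip).
  have dqo i : i != q -> dot (ev i) (ev q) = 0.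
    by move=> iq; rewrite dot_unit_vec (negPf iq).
  have dotDr u w w' : dot u (w + w') = dot u w + dot u w' :> R.
    by rewrite dotC dotDl !(dotC u).
  have dotZr c0 u w : dot u (c0 *: w) = c0 * dot u w :> R.
    by rewrite dotC dotZl (dotC u).
  have dotNr u w : dot u (- w) = - dot u w :> R by rewrite dotC dotNl (dotC u).
  have ss : s * s = 2^-1 by [].
  move=> i j; rewrite /r.
  case: (eqVneq i p) => [->|ip]; last case: (eqVneq i q) => [->|iq].
  + case: (eqVneq j p) => [_|jp]; last case: (eqVneq j q) => [_|jq].
    * rewrite !(dotZl, dotZr, dotDl, dotDr, dotNl, dotNr) ?(dpp, dqq, dpq, dqp, eqxx).
      by rewrite mulrA ss /=; lra.
    * rewrite !(dotZl, dotZr, dotDl, dotDr, dotNl, dotNr) ?(dpp, dqq, dpq, dqp, eqxx).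
      by rewrite mulrA ss /=; lra.
    * by rewrite dotC dotZr dotDr dpo// dqo// addr0 mulr0.
  + case: (eqVneq j p) => [->|jp]; last case: (eqVneq j q) => [_|jq].
    * rewrite !(dotZl, dotZr, dotDl, dotDr, dotNl, dotNr) ?(dpp, dqq, dpq, dqp, eqxx).
      by rewrite (negPf qp) mulrA ss /=; lra.
    * rewrite !(dotZl, dotZr, dotDl, dotDr, dotNl, dotNr) ?(dpp, dqq, dpq, dqp, eqxx).
      by rewrite mulrA ss /=; lra.
    * by rewrite dotC dotZr dotDr dotNr dpo// dqo// subr0 mulr0.
  + case: (eqVneq j p) => [->|jp]; last case: (eqVneq j q) => [->|jq].
    * by rewrite (negPf ip) dotZr dotDr dpo// dqo// addr0 mulr0.
    * by rewrite (negPf iq) dotZr dotDr dotNr dpo// dqo// subr0 mulr0.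
    * by rewrite dot_unit_vec.
Qed.

End FourFold.

(** * Index functions with prescribed fibres and the canonical index *)

Lemma extend_perm (A : finType) (f g : nat -> A) n :
  (forall a b, (a < n)%N -> (b < n)%N -> (f a == f b) = (g a == g b)) ->
  exists s : {perm A}, forall a, (a < n)%N -> s (f a) = g a.
Proof.
elim: n => [|n IH] fg; first by exists 1%g.
have [|s sE] := IH; first by move=> a b an bn; rewrite fg// ltnW.
(* Composing with this transposition corrects the value at [f n] and does not disturb the earlier
   values: those differ from both exchanged points unless [f a = f n]. *)
exists (s * tperm (s (f n)) (g n))%g => a; rewrite ltnS leq_eqVlt permM.
move=> /predU1P[->|an]; first by rewrite tpermL.
have fgn := fg a n (ltnW an) (ltnSn n).
case: (eqVneq (f a) (f n)) fgn => [-> /esym/eqP ->|fan /esym /negbT gan].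
  by rewrite tpermL.
by rewrite -(sE _ an) tpermD// ?(inj_eq perm_inj) 1?eq_sym// sE.
Qed.

(** The value type is left arbitrary, to cover both [canon_idx] with values in [nat] and the indices
    in ['I_N] of a moment. *)
Definition strongly_admissible (A : eqType) k m (f : nat -> A) :=
  forall a b, (a < k.*2)%N -> (b < k.*2)%N ->
    (f a == f b) = (a == b) || (m a == b).

Section CanonicalIndex.
Context (k : nat) (m : nat -> nat) (pm : is_pairing k m).

Let leader b := (b < m b)%N.

(** The involution [m] exchanges the minima of the blocks with the remaining positions, so each kind
    makes up half of the total. *)
Lemma count_leader : count leader (iota 0 k.*2) = k.
Proof.
set s := iota 0 k.*2.
have sE x : (x \in s) = (x < k.*2)%N by rewrite mem_iota add0n.
have ms : perm_eq (map m s) s.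
  have minj : {in s &, injective m}.
    move=> x y; rewrite !sE => /pm[_ _ mmx] /pm[_ _ mmy] mxy.
    by rewrite -mmx mxy.
  apply: uniq_perm; rewrite ?map_inj_in_uniq ?iota_uniq// => x.
  apply/mapP/idP => [[y]|]; rewrite !sE; first by move=> /pm[? _ _] ->.
  by move=> /pm[mx _ mmx]; exists (m x); rewrite ?sE.
have : count leader s = count (predC leader) s.
  rewrite -[RHS](seq.permP ms) count_map; apply: eq_in_count => x.
  by rewrite sE => /pm[_ mx mmx]; rewrite /= /leader mmx; lia.
by have := count_predC leader s; rewrite size_iota; lia.
Qed.

Lemma min_lt a : (a < k.*2)%N -> (minn a (m a) < k.*2)%N.
Proof. by move=> ak; lia. Qed.

Lemma leader_min a : (a < k.*2)%N -> leader (minn a (m a)).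
Proof.
move=> ak; have [_ ma mma] := pm ak.
by rewrite /leader /minn; case: ifP; rewrite ?mma; lia.
Qed.

Lemma count_lt (p q : pred nat) x s : uniq s -> subpred p q -> x \in s ->
  q x -> ~~ p x -> (count p s < count q s)%N.
Proof.
move=> us pq xs qx px.
have := count_predUI p (pred1 x) s; rewrite (count_uniq_mem _ us) xs.
rewrite (@eq_count _ (predI p (pred1 x)) pred0) ?count_pred0; last first.
  by move=> y /=; case: (eqVneq y x) => [->|]; rewrite ?(negPf px) ?andbF.
rewrite addn0 addn1 => <-; apply: sub_count => y /= /orP[/pq//|/eqP->//].
Qed.

(** The minimum of the block of [a] is one of the [k] leaders and is not counted by
    [canon_idx k m a]. *)
Lemma canon_idx_lt a : (a < k.*2)%N -> (canon_idx k m a < k)%N.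
Proof.
move=> ak; rewrite -[ltnRHS]count_leader.
apply: (@count_lt _ _ (minn a (m a))); rewrite ?iota_uniq//.
- by move=> b /andP[].
- by rewrite mem_iota add0n min_lt.
- exact: leader_min.
- by rewrite ltnn andbF.
Qed.

(** The canonical index depends only on the minimum of the block and increases strictly with it, so
    it separates the blocks. *)
Lemma canon_idx_admissible : strongly_admissible k m (canon_idx k m).
Proof.
have canon_mono a b : (a < k.*2)%N -> (b < k.*2)%N ->
    (minn a (m a) < minn b (m b))%N -> (canon_idx k m a < canon_idx k m b)%N.
  move=> ak bk ab; apply: (@count_lt _ _ (minn a (m a))); rewrite ?iota_uniq//.
  - by move=> c /andP[-> ca]; exact: ltn_trans ca ab.
  - by rewrite mem_iota add0n min_lt.
  - by rewrite ab andbT; exact: leader_min.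
  - by rewrite ltnn andbF.
move=> a b ak bk; have [mak ma mma] := pm ak; have [mbk mb mmb] := pm bk.
apply/eqP/orP => [canon_ab|].
  have : minn a (m a) = minn b (m b).
    case: (ltngtP (minn a (m a)) (minn b (m b))) => // ab.
      by have := canon_mono _ _ ak bk ab; rewrite canon_ab ltnn.
    by have := canon_mono _ _ bk ak ab; rewrite canon_ab ltnn.
  rewrite /minn; case: ifP => _; case: ifP => _ ab.
  - by rewrite ab; left.
  - by rewrite ab mmb; right.
  - by rewrite ab; right.
  - by rewrite -mma ab mmb; left.
case=> /eqP => [->//|mab]; apply: eq_count => c.
by rewrite -mab mma minnC.
Qed.

End CanonicalIndex.

(** * Transpositions acting on pairings *)

Lemma transpK a b : involutive (transp a b).
Proof.
move=> x; rewrite /transp.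
case: (eqVneq x a) => [->|xa]; first by rewrite eqxx; case: eqVneq.
by case: (eqVneq x b) => [->|xb]; rewrite ?eqxx// (negPf xa) (negPf xb).
Qed.

Lemma transp_lt n a b x :
  (a < n)%N -> (b < n)%N -> (x < n)%N -> (transp a b x < n)%N.
Proof. by rewrite /transp; case: ifP => _ //; case: ifP. Qed.

Lemma act_transp_pairing k m a b : is_pairing k m ->
  (a < k.*2)%N -> (b < k.*2)%N -> is_pairing k (act_transp a b m).
Proof.
move=> pm ak bk x xk; have [] := pm _ (transp_lt ak bk xk).
move=> mk mx mmx; rewrite /act_transp/= transpK mmx transpK.
split=> //; first exact: transp_lt.
by rewrite -(inj_eq (inv_inj (transpK a b))) transpK.
Qed.

Lemma act_transp_admissible (A : eqType) k m (f : nat -> A) a b :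
  strongly_admissible k m f -> (a < k.*2)%N -> (b < k.*2)%N ->
  strongly_admissible k (act_transp a b m) (f \o transp a b).
Proof.
move=> fm ak bk x y xk yk; rewrite /act_transp/= fm ?transp_lt//.
rewrite (inj_eq (inv_inj (transpK a b))); congr (_ || _).
by rewrite -[in RHS](inj_eq (inv_inj (transpK a b))) transpK.
Qed.

(** * The Weingarten function as a moment, and insertion of an index *)

Section Recurrence.
Context (R : realType) (d : measure_display) (T : measurableType d)
        (P : probability T R) (N : nat) (O : 'I_N -> 'I_N -> T -> R) (M : nat).
Hypothesis haarO : haar_orthogonal P O.

Definition index_moment k (f : nat -> 'I_N) : R :=
  moment P O M k (@unit_vec R N \o f).

Lemma eq_index_moment k f g : (forall x, (x < k.*2)%N -> f x = g x) ->
  index_moment k f = index_moment k g.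
Proof. by move=> fg; apply: eq_moment => x xk /=; rewrite fg. Qed.

Lemma qform_unit_vec t i j :
  qform M (Omat O t) (unit_vec R i) (unit_vec R j) = Amat O M t i j.
Proof.
rewrite /qform -rowE trmx_delta -colE !mxE.
by [].
Qed.

Lemma index_momentE k f : index_moment k f =
  \int[P]_t \prod_(j < k) Amat O M t (f j.*2) (f j.*2.+1).
Proof.
by apply: eq_Rintegral => t _; apply: eq_bigr => j _; rewrite qform_unit_vec.
Qed.

Lemma index_moment_perm k (s : {perm 'I_N}) f :
  index_moment k (s \o f) = index_moment k f.
Proof.
apply: (moment_frame haarO M k f (r := @unit_vec R N \o s)) => i j.
by rewrite dot_unit_vec (inj_eq perm_inj).
Qed.

(** Two strongly admissible functions have the same fibres, so a permutation of ['I_N] carries one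
    to the other, and permutation matrices are orthogonal. *)
Lemma WgA_admissible k m f : (k <= N)%N -> is_pairing k m ->
  strongly_admissible k m f -> WgA P O M k m = index_moment k f.
Proof.
move=> kN pm fm; have i0 := f 0%N.
(* The default [i0] is never taken at a position below [k.*2], where the canonical index is below
   [k <= N]. *)
pose g a := insubd i0 (canon_idx k m a).
have gE a : (a < k.*2)%N -> g a = canon_idx k m a :> nat.
  by move=> ak; rewrite val_insubd (leq_trans (canon_idx_lt pm ak) kN).
have -> : WgA P O M k m = index_moment k g.
  rewrite index_momentE; apply: eq_Rintegral => t _; apply: eq_bigr => j _.
  have Wg a b : (a < k.*2)%N -> (b < k.*2)%N ->
      Aent O M t (canon_idx k m a) (canon_idx k m b) = Amat O M t (g a) (g b).
    by move=> ak bk; rewrite /Aent -!gE// !valK.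
  by apply: Wg; have := ltn_ord j; lia.
have [|s sE] := @extend_perm _ f g k.*2.
  move=> a b ak bk; rewrite fm// -(inj_eq val_inj) /= !gE//.
  by rewrite canon_idx_admissible.
by rewrite -(eq_index_moment sE); exact: (index_moment_perm _ s).
Qed.

(* The index [l] is put on the block of [z]; when it collides with the block
   [{a, m a}], the fourfold index splits into its three pairings. *)
Lemma index_moment_slot k m f z l : (k <= N)%N -> is_pairing k m ->
  strongly_admissible k m f -> (z < k.*2)%N ->
  index_moment k (upd (upd f z l) (m z) l) = WgA P O M k m +
  \sum_(a < k.*2 | [&& nat_of_ord a != z, nat_of_ord a != m z & f a == l])
     WgA P O M k (act_transp a z m).
Proof.
move=> kN pm fm zk; have [mzk mzz mmz] := pm _ zk.
case: (pickP (fun a : 'I_(k.*2) =>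
  [&& nat_of_ord a != z, nat_of_ord a != m z & f a == l])) => [a|nol]; last first.
  (* Without a collision the sum is empty and the updated index is still strongly admissible. *)
  rewrite big_pred0// addr0; symmetry; apply: WgA_admissible => //.
  have flN x : (x < k.*2)%N -> x != z -> x != m z -> (f x == l) = false.
    by move=> xk xz xmz; have := nol (Ordinal xk); rewrite /= xz xmz.
  move=> x y xk yk; have [mxk mxx mmx] := pm _ xk.
  have mmz' : (m x == m z) = (x == z).
    by apply/eqP/eqP => [|->//]; move=> /(congr1 m); rewrite mmx mmz.
  have mz' : (m x == z) = (x == m z).
    by apply/eqP/eqP => [<-|->//]; rewrite mmx.
  rewrite /upd.
  case: (eqVneq y (m z)) => [->|ymz]; case: (eqVneq x (m z)) => [->|xmz];
    rewrite ?eqxx//.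
  - case: (eqVneq x z) => [->|xz]; first by rewrite !eqxx orbT.
    by rewrite flN// mmz' (negPf xz).
  - rewrite mmz; case: (eqVneq y z) => [->|yz]; first by rewrite !eqxx orbT.
    by rewrite (eq_sym l) flN// eq_sym (negPf ymz).
  - case: (eqVneq y z) => [->|yz].
      case: (eqVneq x z) => [->|xz]; rewrite ?eqxx//.
      by rewrite flN// mz' (negPf xmz).
    case: (eqVneq x z) => [->|xz].
      by rewrite (eq_sym l) flN// eq_sym (negPf yz) eq_sym (negPf ymz).
    exact: fm.
case/and3P=> az amz /eqP fal.
have ak := ltn_ord a; have [mak maa mma] := pm _ ak.
have maz : m a != z.
  by apply: contraNneq amz => <-; rewrite mma.
have mamz : m a != m z.
  by apply: contraNneq az => /(congr1 m); rewrite mma mmz => ->.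
have fma : f (m a) = l by apply/eqP; rewrite -fal fm// mma eqxx orbT.
have fmz : f (m z) = f z by apply/eqP; rewrite fm// mmz eqxx orbT.
have lfz : l != f z by rewrite -fal fm// negb_or az maz.
(* By admissibility only [a] and [m a] carry the index [l], so the sum has exactly two terms. *)
rewrite (bigD1 a)/=; last by rewrite az amz fal eqxx.
rewrite (bigD1 (Ordinal mak))/=; last first.
  by rewrite maz mamz fma eqxx -(inj_eq val_inj)/= maa.
rewrite big1 ?addr0; last first.
  move=> b /andP[/andP[/and3P[bz bmz fb]]].
  rewrite -!(inj_eq val_inj)/= => ba bma.
  by move: fb; rewrite -fal fm// (negPf ba)/= eq_sym => /eqP mb;
    move: bma; rewrite mb; have [_ _ ->] := pm _ (ltn_ord b); rewrite eqxx.
have four := @moment_four R d T P N O M haarO k f a (m a) z (m z) l (f z).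
rewrite (@WgA_admissible k m f)//.
rewrite (@WgA_admissible k _ (f \o transp a z))//; last 2 first.
- exact: act_transp_pairing.
- exact: act_transp_admissible.
rewrite (@WgA_admissible k _ (f \o transp (m a) z))//; last 2 first.
- exact: act_transp_pairing.
- exact: act_transp_admissible.
have other x : (x < k.*2)%N -> x \notin [:: nat_of_ord a; m a; z; m z] ->
    (f x != l) && (f x != f z).
  move=> xk; rewrite !inE !negb_or => /and4P[xa xma xz xmz].
  rewrite -fal !fm// !negb_or xa xz/=.
  have [_ _ mmx] := pm _ xk.
  apply/andP; split; first by apply: contraNneq xma => <-; rewrite mmx.
  by apply: contraNneq xmz => <-; rewrite mmx.
have E1 : index_moment k (upd (upd f z l) (m z) l) =
    index_moment k (upd4 f a (m a) z (m z) l l l l).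
  apply: eq_index_moment => x xk; rewrite /upd4 /upd.
  case: (eqVneq x a) => [->|xa].
    by rewrite (negPf amz) (negPf az).
  case: (eqVneq x (m a)) => [->|xma]; first by rewrite (negPf mamz) (negPf maz).
  by case: (eqVneq x z); case: (eqVneq x (m z)).
have E2 : index_moment k f = index_moment k (upd4 f a (m a) z (m z) l l (f z) (f z)).
  apply: eq_index_moment => x xk; rewrite /upd4 /upd.
  case: (eqVneq x a) => [->//|xa].
  case: (eqVneq x (m a)) => [->//|xma].
  case: (eqVneq x z) => [->//|xz].
  by case: (eqVneq x (m z)) => [->|].
have E3 : index_moment k (f \o transp a z) =
    index_moment k (upd4 f a (m a) z (m z) l (f z) (f z) l).
  (* The positions [a], [m a], [z], [m z] carry [f z], [l], [l], [f z]; exchanging the two values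
     gives the pattern of [moment_four]. *)
  rewrite -(index_moment_perm _ (tperm l (f z))).
  apply: eq_index_moment => x xk; rewrite /upd4 /upd /transp /=.
  case: (eqVneq x a) => [_|xa]; first by rewrite tpermR.
  case: (eqVneq x (m a)) => [->|xma]; first by rewrite (negPf maz) fma tpermL.
  case: (eqVneq x z) => [_|xz]; first by rewrite fal tpermL.
  case: (eqVneq x (m z)) => [->|xmz]; first by rewrite fmz tpermR.
  have /andP[fl fz] : (f x != l) && (f x != f z).
    by apply: other; rewrite // !inE !negb_or xa xma xz.
  by rewrite tpermD// eq_sym.
have E4 : index_moment k (f \o transp (m a) z) =
    index_moment k (upd4 f a (m a) z (m z) l (f z) l (f z)).
  apply: eq_index_moment => x xk; rewrite /upd4 /upd /transp /=.
  case: (eqVneq x a) => [->|xa]; first by rewrite eq_sym (negPf maa) (negPf az).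
  case: (eqVneq x (m a)) => [_//|xma].
  case: (eqVneq x z) => [_//|xz].
  by case: (eqVneq x (m z)) => [->|].
rewrite E1 E2 E3 E4 [LHS]four//.
- by rewrite /index_moment; ring.
- by rewrite ak mak zk mzk.
- by rewrite /= !inE !negb_or (eq_sym (a : nat)) maa az amz maz mamz eq_sym mzz.
Qed.

End Recurrence.

(** * Summation over the inserted index, in two ways *)

Section Contraction.
Context (R : realType) (d : measure_display) (T : measurableType d)
        (P : probability T R) (N : nat) (O : 'I_N -> 'I_N -> T -> R) (M : nat).
Hypothesis haarO : haar_orthogonal P O.
Hypothesis MN : (M <= N)%N.

(** A position [a] off the block of [z] collides with exactly one value of [l], namely [f a]; the
    term without collision is counted for each of the [N] values. *)
Lemma sum_index_moment_slot k m f z : (k <= N)%N -> is_pairing k m ->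
  strongly_admissible k m f -> (z < k.*2)%N ->
  \sum_l index_moment P O M k (upd (upd f z l) (m z) l) =
  N%:R * WgA P O M k m +
  \sum_(a < k.*2 | (nat_of_ord a != z) && (nat_of_ord a != m z))
     WgA P O M k (act_transp a z m).
Proof.
move=> kN pm fm zk.
under eq_bigr do rewrite (index_moment_slot M haarO _ kN pm fm zk).
rewrite big_split/= sumr_const card_ord mulr_natl; congr (_ + _).
rewrite (exchange_big_dep (fun a : 'I_(k.*2) =>
  (nat_of_ord a != z) && (nat_of_ord a != m z)))/=; last first.
  by move=> l a _ /and3P[-> ->].
apply: eq_bigr => a /andP[az amz]; rewrite (bigD1 (f a))/=; last first.
  by rewrite az amz eqxx.
rewrite big1 ?addr0// => l /andP[/and3P[_ _ /eqP->]].
by rewrite eqxx.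
Qed.

Lemma Amat_sym t i j : Amat O M t i j = Amat O M t j i.
Proof.
suff AT : (Amat O M t)^T = Amat O M t by rewrite -[in LHS]AT mxE.
by rewrite /Amat !trmx_mul trmxK tr_pid_mx mulmxA.
Qed.

Lemma trmx_Omat_mul t : (Omat O t)^T *m Omat O t = 1%:M.
Proof. exact/mulmx1C/(Omat_orthogonal haarO). Qed.

Lemma Amat_idem t i j : \sum_l Amat O M t i l * Amat O M t l j = Amat O M t i j.
Proof.
suff AA : Amat O M t *m Amat O M t = Amat O M t by rewrite -[in RHS]AA mxE.
rewrite /Amat !mulmxA -(mulmxA _ _^T) trmx_Omat_mul mulmx1.
by rewrite -(mulmxA _ (pid_mx M) (pid_mx M)) pid_mx_id.
Qed.

Lemma Amat_trace t : \sum_l Amat O M t l l = M%:R.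
Proof.
transitivity (\tr (Amat O M t)); first by [].
rewrite /Amat mxtrace_mulC mulmxA trmx_Omat_mul mul1mx /mxtrace.
under eq_bigr do rewrite mxE eqxx /=.
rewrite -natr_sum -big_mkcond/= (big_ord_narrow MN).
by rewrite sum1_card card_ord.
Qed.

Lemma Rintegral_sum (I : Type) (s : seq I) (F : I -> T -> R) :
  (forall i, P.-integrable setT (EFin \o F i)) ->
  \sum_(i <- s) \int[P]_t F i t = \int[P]_t \sum_(i <- s) F i t.
Proof.
move=> iF.
have : P.-integrable setT (EFin \o (fun t => \sum_(i <- s) F i t)) /\
    \sum_(i <- s) \int[P]_t F i t = \int[P]_t \sum_(i <- s) F i t.
  elim: s => [|i s [IHi IH]].
    rewrite (_ : (fun t => _) = fun=> 0); last first.
      by apply/funext => t; rewrite big_nil.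
    split; first exact: integrable0.
    by rewrite big_nil Rintegral_cst// mul0r.
  rewrite (_ : (fun t => _) = fun t => F i t + \sum_(j <- s) F j t); last first.
    by apply/funext => t; rewrite big_cons.
  split; first exact: (integrableD measurableT (iF i) IHi).
  by rewrite big_cons IH -RintegralD.
by case.
Qed.

Lemma integrable_index_moment k f : P.-integrable setT
  (EFin \o (fun t => \prod_(j < k) Amat O M t (f j.*2) (f j.*2.+1))).
Proof.
have := integrable_moment haarO M k (@unit_vec R N \o f).
congr (_.-integrable _ _); apply/funext => t /=; congr EFin.
by apply: eq_bigr => j _; rewrite qform_unit_vec.
Qed.

(** The index [l] fills both places of the last factor, which sums to the trace of A. *)
Lemma sum_index_moment_trace k f :
  \sum_l index_moment P O M k.+1 (upd (upd f k.*2 l) k.*2.+1 l) =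
  M%:R * index_moment P O M k f.
Proof.
under eq_bigr do rewrite index_momentE.
rewrite Rintegral_sum; last by move=> l; exact: integrable_index_moment.
rewrite index_momentE -RintegralZl//; last exact: integrable_index_moment.
apply: eq_Rintegral => t _; rewrite -(Amat_trace t) mulr_suml.
apply: eq_bigr => l _; rewrite big_ord_recr/= mulrC.
rewrite /upd !eqxx ltn_eqF//; congr (_ * _); apply: eq_bigr => j _.
by have jk := ltn_ord j; rewrite !ifN//; lia.
Qed.

(** The index [l] is shared by the last factor and the factor containing [a]. Since A is idempotent
    they merge into one factor, with [f k.*2.+1] at position [a]; for even [a] the symmetry of A
    first aligns the indices. *)
Lemma sum_index_moment_idem k f a : (a < k.*2)%N ->
  \sum_l index_moment P O M k.+1 (upd (upd f k.*2 l) a l) =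
  index_moment P O M k (upd f a (f k.*2.+1)).
Proof.
move=> ak; under eq_bigr do rewrite index_momentE.
rewrite Rintegral_sum; last by move=> l; exact: integrable_index_moment.
rewrite index_momentE; apply: eq_Rintegral => t _.
rewrite (prod_upd (fun i j => Amat O M t i j))//.
set rest := \prod_(j < k | _) _.
transitivity (\sum_l (if odd a then Amat O M t (f a.-1) l
    else Amat O M t l (f a.+1)) * Amat O M t l (f k.*2.+1) * rest).
  apply: eq_bigr => l _; rewrite big_ord_recr/=.
  have -> : \prod_(j < k) Amat O M t (upd (upd f k.*2 l) a l j.*2)
      (upd (upd f k.*2 l) a l j.*2.+1) =
      \prod_(j < k) Amat O M t (upd f a l j.*2) (upd f a l j.*2.+1).
    apply: eq_bigr => j _; have jk := ltn_ord j; rewrite /upd.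
    have /negPf -> : j.*2 != k.*2 by clear -jk; lia.
    by have /negPf -> : j.*2.+1 != k.*2 by clear -jk; lia.
  rewrite (prod_upd (fun i j => Amat O M t i j))// mulrAC; congr (_ * _ * _).
  have /negPf ka : k.*2 != a by clear -ak; lia.
  have /negPf ka1 : k.*2.+1 != a by clear -ak; lia.
  by rewrite /upd ka ka1 eqxx gtn_eqF.
rewrite -mulr_suml; congr (_ * _); case: ifP => _; first exact: Amat_idem.
rewrite -[RHS]Amat_idem; apply: eq_bigr => l _.
by rewrite mulrC (Amat_sym t l (f k.*2.+1)).
Qed.

End Contraction.

(** * Deletion of the last block, and assembly of the recurrence *)

Lemma pairing_restrict k m : is_pairing k.+1 m -> m k.*2 = k.*2.+1 ->
  is_pairing k m.
Proof.
move=> pm mk a ak.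
have [ak1 k1 k2] : [/\ (a < k.+1.*2)%N, (k.*2 < k.+1.*2)%N & (k.*2.+1 < k.+1.*2)%N].
  by split; lia.
have [mak maa mma] := pm _ ak1; split=> //.
have : m a != k.*2 by apply/eqP => ma; move: mma; rewrite ma mk; lia.
have : m a != k.*2.+1.
  apply/eqP => ma; move: mma; rewrite ma -mk.
  by have [_ _ ->] := pm _ k1; lia.
by lia.
Qed.

Lemma admissible_restrict (A : eqType) k m (f : nat -> A) :
  strongly_admissible k.+1 m f -> strongly_admissible k m f.
Proof. by move=> fm a b ak bk; apply: fm; lia. Qed.

(* Both actions turn the blocks [{z, m z}], [{y, m y}] into [{z, y}],
   [{m z, m y}]. *)
Lemma act_transp_dual k m y z x : is_pairing k m -> (y < k.*2)%N ->
  (z < k.*2)%N -> (x < k.*2)%N -> y != z -> m z != y ->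
  act_transp (m y) z m x = act_transp (m z) y m x.
Proof.
move=> pm yk zk xk yz mzy.
have [myk myy mmy] := pm _ yk; have [mzk mzz mmz] := pm _ zk.
have [mxk mxx mmx] := pm _ xk.
have myz : m y != z by apply: contraNneq mzy => <-; rewrite mmy.
have mymz : m y != m z by apply: contraNneq yz => /(congr1 m); rewrite mmy mmz => ->.
have neqs := (negPf yz, negPf mzy, negPf myy, negPf mzz, negPf myz, negPf mymz).
rewrite eq_sym in yz; rewrite eq_sym in mzy; rewrite eq_sym in myy.
rewrite eq_sym in mzz; rewrite eq_sym in myz; rewrite eq_sym in mymz.
have neqs' := (negPf yz, negPf mzy, negPf myy, negPf mzz, negPf myz, negPf mymz).
rewrite /act_transp/= /transp.
case: (eqVneq x (m y)) => [->|xmy]; first by rewrite !(mmy, neqs, neqs', eqxx).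
case: (eqVneq x z) => [->|xz]; first by rewrite !(mmy, neqs, neqs', eqxx).
case: (eqVneq x (m z)) => [->|xmz]; first by rewrite !(mmz, neqs, neqs', eqxx).
case: (eqVneq x y) => [->|xy]; first by rewrite !(mmz, neqs, neqs', eqxx).
have -> : (m x == m y) = false.
  by apply: contraNF xy => /eqP/(congr1 m); rewrite mmx mmy => ->.
have -> : (m x == z) = false by apply: contraNF xmz => /eqP <-; rewrite mmx.
have -> : (m x == m z) = false.
  by apply: contraNF xz => /eqP/(congr1 m); rewrite mmx mmz => ->.
have -> // : (m x == y) = false by apply: contraNF xmy => /eqP <-; rewrite mmx.
Qed.

(** The transposition preserves the block of [z] and fixes every position outside it. *)
Lemma act_transp_block k m z x : is_pairing k m -> (z < k.*2)%N ->
  (x < k.*2)%N -> act_transp (m z) z m x = m x.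
Proof.
move=> pm zk xk; have [_ mzz mmz] := pm _ zk; have [_ _ mmx] := pm _ xk.
rewrite /act_transp/= /transp.
case: (eqVneq x (m z)) => [->|xmz]; first by rewrite eqxx mmz.
case: (eqVneq x z) => [->|xz].
  by rewrite mmz [z == m z]eq_sym (negPf mzz) eqxx.
have -> : (m x == m z) = false.
  by apply: contraNF xz => /eqP/(congr1 m); rewrite mmx mmz => ->.
by have -> : (m x == z) = false by apply: contraNF xmz => /eqP <-; rewrite mmx.
Qed.

Lemma eq_admissible (A : eqType) k m m' (f : nat -> A) :
  (forall x, (x < k.*2)%N -> m x = m' x) ->
  strongly_admissible k m f -> strongly_admissible k m' f.
Proof. by move=> mm' fm a b ak bk; rewrite fm// mm'. Qed.

Lemma exists_admissible N k m : (0 < N)%N -> (k <= N)%N -> is_pairing k m ->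
  exists f : nat -> 'I_N, strongly_admissible k m f.
Proof.
move=> N0 kN pm; exists (fun a => insubd (Ordinal N0) (canon_idx k m a)).
move=> a b ak bk; rewrite -(inj_eq val_inj) !val_insubd.
by rewrite !(leq_trans (canon_idx_lt pm _) kN)// canon_idx_admissible.
Qed.

(** Used with [n = z] and [b = m z], it detaches the term of [y = z.+1], which lies outside the
    range of the sums in the recurrence. *)
Lemma sum_skip (V : nmodType) (F : nat -> V) n b :
  \sum_(a < n.+2 | (nat_of_ord a != n) && (nat_of_ord a != b)) F a =
  \sum_(a < n | nat_of_ord a != b) F a + (if n.+1 != b then F n.+1 else 0).
Proof.
rewrite big_mkcond !big_ord_recr/= eqxx/= addr0 gtn_eqF//=; congr (_ + _).
by rewrite [RHS]big_mkcond/=; apply: eq_bigr => a _; rewrite ltn_eqF.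
Qed.

Theorem mainTheorem2 (R : realType) (d : measure_display) (T : measurableType d)
    (P : probability T R) (M N k : nat) (O : 'I_N -> 'I_N -> T -> R)
    (m : nat -> nat) :
  (0 < M)%N -> (M < N)%N -> (1 <= k)%N -> (k <= N)%N ->
  haar_orthogonal P O -> is_pairing k m ->
  WgA P O M k m =
    - N%:R^-1 * \sum_(x < (k.*2 - 2)%N)
        WgA P O M k (act_transp x ((k.*2 - 2)%N) m)
    + M%:R / N%:R * (m ((k.*2 - 2)%N) == (k.*2 - 1)%N)%:R * WgA P O M k.-1 m
    + N%:R^-1 * \sum_(x < (k.*2 - 2)%N)
        (m x == (k.*2 - 1)%N)%:R * WgA P O M k.-1 (act_transp x ((k.*2 - 2)%N) m).
Proof.
case: k => // k _ MN _ kN haarO pm.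
have -> : (k.+1.*2 - 2)%N = k.*2 by lia.
have -> : (k.+1.*2 - 1)%N = k.*2.+1 by lia.
rewrite [k.+1.-1]/=; set z := k.*2; set y := z.+1.
have zk : (z < k.+1.*2)%N by rewrite doubleS; lia.
have yk : (y < k.+1.*2)%N by rewrite doubleS.
have [mzk mzz mmz] := pm _ zk; have [myk myy mmy] := pm _ yk.
have N0 : (0 < N)%N by exact: leq_trans MN.
have NR0 : N%:R != 0 :> R by rewrite pnatr_eq0 -lt0n.
have [f fm] := exists_admissible N0 kN pm.
have := sum_index_moment_slot M haarO kN pm fm zk.
rewrite [in X in _ + X]doubleS (sum_skip (fun a => WgA P O M k.+1 (act_transp a z m))).
case: (eqVneq (m z) y) => [mzy|mzy].
  rewrite mzy /= addr0 (sum_index_moment_trace haarO (ltnW MN)).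
  (* Deleting the block of [z] and [y] keeps the function [m] and only lowers the level to [k], as
     values beyond [k.*2] are irrelevant. *)
  rewrite -(WgA_admissible M haarO (ltnW kN) (pairing_restrict pm mzy)
    (admissible_restrict fm)).
  under eq_bigl => a do rewrite ltn_eqF ?(ltn_trans (ltn_ord a))//.
  (* The partner of [y] is [z] itself, so no [x] below [z] contributes to the last sum. *)
  rewrite [X in _ = _ + _ + _ * X]big1 => [|x _]; last first.
    case: eqP => [mxy|]; last by rewrite mul0r.
    have xk : (x < k.+1.*2)%N by rewrite (ltn_trans (ltn_ord x)).
    have [_ _] := pm _ xk; rewrite mxy -mzy mmz => zx.
    by have := ltn_ord x; rewrite -zx ltnn.
  move=> key; rewrite mulr0 addr0 mulr1 -mulrA [_^-1 * _]mulrC mulrA key.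
  by field.
have mzz' : (m z < z)%N by move: mzk mzz mzy; rewrite doubleS /y; lia.
have myz : m y != z by apply: contraNneq mzy => <-; rewrite mmy.
have myz' : (m y < z)%N by move: myk myy myz; rewrite doubleS /y; lia.
rewrite /= (sum_index_moment_idem haarO (ltnW MN))//.
have yz : y != z by rewrite gtn_eqF.
(* Below [z], the contracted index is [f \o transp (m z) y]. It is admissible for
   [act_transp (m z) y m], which agrees with [act_transp (m y) z m]; there [z] and [y] form a block
   that can be deleted. *)
have -> : index_moment P O M k (upd f (m z) (f y)) =
    WgA P O M k (act_transp (m y) z m).
  have pa := act_transp_pairing pm myk zk.
  have az : act_transp (m y) z m z = y.
    by rewrite /act_transp/= /transp eqxx [z == m y]eq_sym (negPf myz) mmy
      [y == m y]eq_sym (negPf myy) (negPf yz).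
  rewrite (WgA_admissible M haarO (ltnW kN) (pairing_restrict pa az)
    (f := f \o transp (m z) y)).
    apply: eq_index_moment => x xk; rewrite /upd /transp /=.
    by case: eqVneq => // _; rewrite ltn_eqF// ltnW.
  apply/admissible_restrict/eq_admissible/(act_transp_admissible fm mzk yk).
  by move=> x xk; rewrite -(act_transp_dual pm yk zk xk).
have Wmz : WgA P O M k.+1 (act_transp (m z) z m) = WgA P O M k.+1 m.
  rewrite !(WgA_admissible M haarO kN _ (f := f))//.
    exact: act_transp_pairing.
  by apply: eq_admissible fm => x xk; rewrite (act_transp_block pm).
(* Exchanging [z] and [y] only transposes the last factor, and A is symmetric. *)
have Wy : WgA P O M k.+1 (act_transp y z m) = WgA P O M k.+1 m.
  rewrite (WgA_admissible M haarO kN pm fm).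
  rewrite (WgA_admissible M haarO kN (act_transp_pairing pm yk zk)
    (act_transp_admissible fm yk zk)).
  rewrite !index_momentE; apply: eq_Rintegral => t _.
  rewrite !big_ord_recr/=; congr (_ * _).
    apply: eq_bigr => j _; have jk := ltn_ord j.
    by rewrite /transp !ifN// /y /z; lia.
  by rewrite /transp -/z -/y !eqxx [z == y]eq_sym (negPf yz) Amat_sym.
rewrite Wy mulr0 mul0r addr0.
(* The term [m z] of the full sum matches the detached term [y], both being equal to Wg(m). In the
   last sum only [x = m y] survives. *)
rewrite [X in _ -> _ = - _ * X + _](bigD1 (Ordinal mzz'))//= Wmz.
rewrite [X in _ -> _ = _ + _ * X](bigD1 (Ordinal myz'))//= mmy eqxx mul1r.
rewrite [X in _ -> _ = _ + _ * (_ + X)]big1 => [|x xmy]; last first.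
  case: eqP => [mxy|]; last by rewrite mul0r.
  have xk : (x < k.+1.*2)%N by rewrite (ltn_trans (ltn_ord x)).
  have [_ _] := pm _ xk; rewrite mxy => yx.
  by move: xmy; rewrite -(inj_eq val_inj)/= yx eqxx.
rewrite addr0 => ->; under eq_bigl do rewrite -(inj_eq val_inj)/=.
by field.
Qed.
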